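(* Suppose $\mathsf Z$ is a metric space with metric $d$. Let $P$ and $Q$ be probability distributions on $\mathsf Z$, and let $a_P,a_Q\in\mathsf A$ satisfy $H_\ell(P)=\mathbb E_P[\ell(Z,a_P)]$ and $H_\ell(Q)=\mathbb E_Q[\ell(Z,a_Q)]$. If $\ell(\cdot,a_Q)$ is $\rho_Q$-Lipschitz with respect to $d$, i.e. $|\ell(z,a_Q)-\ell(z',a_Q)|\le\rho_Q\,d(z,z')$ for all $z,z'\in\mathsf Z$, then $$H_\ell(P)-H_\ell(Q)\le\rho_Q\,\mathcal W_d(P,Q).$$ If $\ell(\cdot,a_P)$ is $\rho_P$-Lipschitz with respect to $d$, then $$H_\ell(Q)-H_\ell(P)\le\rho_P\,\mathcal W_d(P,Q).$$
   Context: $\mathsf A$ is a space of actions and $\ell:\mathsf Z\times\mathsf A\to\mathbb R$ a loss function. The generalized entropy of a distribution $P$ on $\mathsf Z$ is $H_\ell(P)=\inf_{a\in\mathsf A}\mathbb E_P[\ell(Z,a)]$, $Z\sim P$. It is assumed that the infimum is attained for the distributions considered. The Wasserstein distance with respect to $d$ is $\mathcal W_d(P,Q)=\inf_{P_{U,V}\in\Pi(P,Q)}\mathbb E[d(U,V)]$, where $\Pi(P,Q)$ is the set of joint distributions on $\mathsf Z\times\mathsf Z$ with marginals $P$ and $Q$. *)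

(* Defs.v *)
From HB Require Import structures.
From mathcomp Require Import all_boot all_order all_algebra.
From mathcomp Require Import all_classical all_reals all_analysis.

Set Implicit Arguments.
Unset Strict Implicit.
Unset Printing Implicit Defensive.

Import Order.TTheory GRing.Theory Num.Theory.
Local Open Scope classical_set_scope.
Local Open Scope ring_scope.
Local Open Scope ereal_scope.

(* The library's measurable types carry a distinguished point, its metric
   spaces need not. Asking for one is no restriction here: a space that carries
   a probability measure is nonempty. *)
#[short(type="pmetricType")]
HB.structure Definition PointedMetric (K : numDomainType) :=
  {T of PseudoPointedMetric K T & Metric K T}.

(* [T] with its Borel sigma-algebra. *)
Notation borel T := (g_sigma_algebraType (@open T)).

Section generalized_entropy_and_wasserstein.
Context {R : realType} {Z : pmetricType R}.

(* The expectation and the infimum are taken in the extended reals, so no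
   integrability is built in; for entropies that are finite, differences of
   [gen_entropy] are differences of real numbers. *)
Definition gen_entropy {A : Type} (l : Z -> A -> R)
    (P : probability (borel Z) R) : \bar R :=
  ereal_inf [set 'E_P[fun z => l z a] | a in [set: A]].

(* Joint distributions live on the Borel sigma-algebra of the product topology,
   for which [mdist] is measurable in every metric space. It contains the
   product of the Borel sigma-algebras, with equality when [Z] is separable. *)
Definition couplings (P Q : probability (borel Z) R) :
    set (probability (borel (Z * Z)%type) R) :=
  [set PUV | forall B : set (borel Z), measurable B ->
     PUV [set uv | B uv.1] = P B /\ PUV [set uv | B uv.2] = Q B].

Definition wasserstein (P Q : probability (borel Z) R) : \bar R :=
  ereal_inf [set 'E_PUV[fun uv : Z * Z => mdist uv.1 uv.2]
            | PUV in couplings P Q].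

End generalized_entropy_and_wasserstein.

(* Main.v *)
(* For a coupling of [P] and [Q] the two expectations of a Lipschitz loss become
   expectations of [f u] and [f v] under one measure, and their difference is at
   most [rho] times the expected distance; the infimum over couplings and the
   optimality of the action give the bound. When [rho <= 0] the loss is
   constant, and when [rho < 0] the space is a single point. *)
From HB Require Import structures.
Require Import Defs.
From mathcomp Require Import all_boot all_order all_algebra.
From mathcomp Require Import all_classical all_reals all_analysis.
From mathcomp Require Import measurable_realfun lra.

Set Implicit Arguments.
Unset Strict Implicit.
Unset Printing Implicit Defensive.

Import Order.TTheory GRing.Theory Num.Theory.
Local Open Scope ring_scope.
Local Open Scope ereal_scope.

Section integral_auxiliary.
Local Open Scope classical_set_scope.
Context {R : realType}.

(** No sign or integrability of [f] is needed: the integral is the difference of those of [f^\+] and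
    [f^\-], and each obeys the nonnegative change of variables. *)
Lemma integral_image_measure d1 d2 (X : measurableType d1)
    (Y : measurableType d2) (mu : {measure set X -> \bar R})
    (nu : {measure set Y -> \bar R}) (phi : X -> Y) (f : Y -> \bar R) :
  measurable_fun [set: X] phi ->
  (forall A, measurable A -> nu A = mu (phi @^-1` A)) ->
  measurable_fun [set: Y] f ->
  \int[nu]_y f y = \int[mu]_x f (phi x).
Proof.
move=> mphi numu mf.
have ge0E (g : Y -> \bar R) : measurable_fun [set: Y] g ->
    (forall y, 0 <= g y) -> \int[nu]_y g y = \int[mu]_x g (phi x).
  move=> mg g0.
  have := ge0_integral_pushforward mphi mu measurableT mg (fun y _ => g0 y).
  rewrite preimage_setT => <-.
  by apply: eq_measure_integral => B mB _; rewrite numu.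
rewrite integralE [RHS]integralE !ge0E//.
- by congr (_ - _); apply: eq_integral => x _; rewrite ?funeposE ?funenegE.
- exact: measurable_funeneg.
- exact: measurable_funepos.
Qed.

(* The difference of the integrals makes sense even if they are infinite: an
   integral that is [-oo] stays so after an integrable perturbation. *)
Lemma integral_sub_le d (T : measurableType d) (mu : {measure set T -> \bar R})
    (X Y k : T -> R) :
  measurable_fun [set: T] X -> measurable_fun [set: T] Y ->
  mu.-integrable [set: T] (EFin \o k) ->
  (forall t, `|X t - Y t| <= k t)%R ->
  \int[mu]_t (X t)%:E - \int[mu]_t (Y t)%:E <= \int[mu]_t (k t)%:E.
Proof.
move=> mX mY ik XYk.
have mEX : measurable_fun [set: T] (EFin \o X) by exact/measurable_EFinP.
have mEY : measurable_fun [set: T] (EFin \o Y) by exact/measurable_EFinP.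
have iXY : mu.-integrable [set: T] (EFin \o (X \- Y)%R).
  apply: (le_integrable measurableT _ _ ik) => [|t _ /=].
    by apply/measurable_EFinP; exact: measurable_funB.
  by rewrite lee_fin (le_trans (XYk t))// ler_norm.
(* If the integral of [Y] is finite, [Y] is integrable and [X = Y + (X - Y)] can be split. *)
have [finY|] := boolP (\int[mu]_t (Y t)%:E \is a fin_num).
  have iY : mu.-integrable [set: T] (EFin \o Y).
    by apply/integrableP; split => //; rewrite integral_fin_num_abs.
  have -> : \int[mu]_t (X t)%:E =
      \int[mu]_t (Y t)%:E + \int[mu]_t ((X \- Y)%R t)%:E.
    rewrite -integralD//; apply: eq_integral => t _ /=.
    by rewrite -EFinD addrC subrK.
  rewrite addeAC subee// add0e; apply: le_integral => // t _ /=.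
  by rewrite lee_fin (le_trans _ (XYk t))// ler_norm.
rewrite fin_numE negb_and !negbK => /orP[/eqP Yoo|/eqP ->]; last first.
  by rewrite addeNy leNye.
(* The integral of [Y] is now [-oo]. In a sum [-oo] absorbs even [+oo], so it suffices that the
   integral of [X] is [-oo] too. *)
suff -> : \int[mu]_t (X t)%:E = -oo by rewrite addNye leNye.
rewrite integralE.
suff -> : \int[mu]_t (EFin \o X)^\- t = +oo by rewrite addeNy.
apply/eqP/negPn/negP; rewrite -ltey => Xnoo.
(* Pointwise, [Y^\-] is at most [X^\- + k]; a finite integral on the right rules out [-oo] for
   [Y]. *)
have : \int[mu]_t (EFin \o Y)^\- t < +oo.
  apply: (@le_lt_trans _ _ (\int[mu]_t ((EFin \o X)^\- t + (k t)%:E))).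
    apply: ge0_le_integral => //.
    - exact: measurable_funeneg.
    - apply: emeasurable_funD; first exact: measurable_funeneg.
      exact: measurable_int ik.
    - move=> t _; rewrite !funenegE /=.
      have := XYk t; rewrite ler_norml => /andP[kt1 kt2].
      have k0 : (0 <= k t)%R by rewrite (le_trans _ (XYk t)).
      rewrite -!EFin_max -EFinD lee_fin ge_max; apply/andP; split.
        rewrite -lerBlDr le_max; apply/orP; left.
        by rewrite lerBlDr -lerBlDl opprK addrC.
      by rewrite addr_ge0// le_max lexx orbT.
  rewrite ge0_integralD//.
  - by rewrite lte_add_pinfty//; exact: integrable_lty.
  - exact: measurable_funeneg.
  - by move=> t _; rewrite lee_fin (le_trans _ (XYk t)).
  - exact: measurable_int ik.
move=> Ynoo; move: Yoo; rewrite integralE.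
have : 0 <= \int[mu]_t (EFin \o Y)^\+ t by exact: integral_ge0.
have : 0 <= \int[mu]_t (EFin \o Y)^\- t by exact: integral_ge0.
move: Ynoo.
by case: (\int[mu]_t (EFin \o Y)^\- t) => // r _ _; case: (\int[mu]_t _) => //.
Qed.

End integral_auxiliary.

Section borel.
Import numFieldNormedType.Exports.
Local Open Scope classical_set_scope.

Lemma borel_measurable_continuous (X Y : ptopologicalType) (f : X -> Y) :
  continuous f -> measurable_fun [set: borel X] (f : borel X -> borel Y).
Proof.
move=> /continuousP cf.
apply: (@measurability _ _ (borel X) (borel Y) _ _ open) => // _ [B oB <-].
by rewrite setTI; apply: sub_sigma_algebra; exact: cf.
Qed.

(** Separate from the previous lemma because [R] carries its own sigma-algebra, here generated by
    the open rays, rather than [borel R]. *)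
Lemma borel_measurable_continuous_real {R : realType} (X : ptopologicalType)
    (f : X -> R) :
  continuous f -> measurable_fun [set: borel X] (f : borel X -> R).
Proof.
move=> /continuousP cf.
apply: (measurability _ (RGenOInfty.measurableE R)) => _ [_ [x ->] <-].
rewrite setTI; apply: sub_sigma_algebra; apply: cf.
exact: interval_open.
Qed.

(** Moving each argument by less than [e / 2] changes the distance by less than [e], by the triangle
    inequality used in both directions. *)
Lemma mdist_continuous {R : realType} (Z : metricType R) :
  continuous (fun uv : Z * Z => mdist uv.1 uv.2).
Proof.
move=> [u v]; apply/cvgrPdist_lt => e e0.
have e20 : (0 < e / 2)%R by rewrite divr_gt0.
exists (ball u (e / 2), ball v (e / 2)); first by split; exact: nbhsx_ballx.
move=> [u' v'] /= [].
rewrite !ballEmdist/= => uu' vv'.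
have := metric_triangle u u' v; have := metric_triangle u' v' v.
have := metric_triangle u' u v'; have := metric_triangle u v v'.
rewrite (metric_sym u' u) (metric_sym v' v) => h1 h2 h3 h4.
by rewrite ltr_norml; apply/andP; split; lra.
Qed.

Lemma lipschitz_continuous {R : realType} (Z : metricType R) (f : Z -> R)
    (rho : R) :
  (forall z z', `|f z - f z'| <= rho * mdist z z')%R -> continuous f.
Proof.
move=> flip x; apply/cvgrPdist_lt => e e0.
(* The sign of [rho] is unknown; [|rho| + 1] is a larger Lipschitz constant by which one can
   divide. *)
have r0 : (0 < `|rho| + 1)%R by rewrite ltr_wpDl.
near=> z; rewrite (le_lt_trans (flip _ _))//.
rewrite (@le_lt_trans _ _ ((`|rho| + 1) * mdist x z)%R)//.
  by rewrite ler_wpM2r ?mdist_ge0// (le_trans (ler_norm _))// lerDl.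
rewrite mulrC -ltr_pdivlMr//; near: z.
have er0 : (0 < e / (`|rho| + 1))%R by rewrite divr_gt0.
by apply: filterS (nbhsx_ballx x _ er0) => z; rewrite ballEmdist.
Unshelve. all: by end_near. Qed.

End borel.

HB.instance Definition _ (X Y : ptopologicalType) := Pointed.on (X * Y)%type.

Section couplings.
Local Open Scope classical_set_scope.
Context {R : realType} {Z : pmetricType R}.
Implicit Types (P Q : probability (borel Z) R) (f : Z -> R) (rho : R).

(** The maps [p] and [q] are abstract so that exchanging the two projections of one coupling yields
    both inequalities. *)
Lemma lipschitz_expectation_sub d (T : measurableType d)
    (pi : probability T R) (p q : T -> borel Z) P Q f rho :
  measurable_fun [set: T] p -> measurable_fun [set: T] q ->
  (forall B, measurable B -> P B = pi (p @^-1` B)) ->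
  (forall B, measurable B -> Q B = pi (q @^-1` B)) ->
  measurable_fun [set: T] (fun t => mdist (p t : Z) (q t)) ->
  (0 < rho)%R ->
  (forall z z', `|f z - f z'| <= rho * mdist z z')%R ->
  'E_P[f] - 'E_Q[f] <= rho%:E * 'E_pi[fun t => mdist (p t : Z) (q t)].
Proof.
move=> mp mq Pp Qq mdpq rho0 flip.
have mf : measurable_fun [set: borel Z] (f : borel Z -> R).
  exact: borel_measurable_continuous_real (lipschitz_continuous flip).
have mEf : measurable_fun [set: borel Z] (EFin \o f : borel Z -> \bar R).
  exact/measurable_EFinP.
rewrite unlock (integral_image_measure mp Pp mEf)
  (integral_image_measure mq Qq mEf).
have mEd : measurable_fun [set: T] (EFin \o (fun t => mdist (p t : Z) (q t))).
  exact/measurable_EFinP.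
have d0 t : [set: T] t -> 0 <= (mdist (p t : Z) (q t))%:E.
  by rewrite lee_fin mdist_ge0.
(* An infinite expected distance makes the bound [+oo], since [rho] is positive. *)
have [doo|] := ltP (\int[pi]_t (mdist (p t : Z) (q t))%:E) +oo; last first.
  by rewrite leye_eq => /eqP ->; rewrite gt0_muley ?lte_fin// leey.
rewrite -ge0_integralZl//; last by rewrite lee_fin ltW.
apply: (integral_sub_le (k := fun t => rho * mdist (p t : Z) (q t))%R) => //.
- exact: measurableT_comp mf mp.
- exact: measurableT_comp mf mq.
- have idist : pi.-integrable [set: T] (fun t => (mdist (p t : Z) (q t))%:E).
    apply/integrableP; split => //.
    by under eq_integral => t _ do rewrite gee0_abs ?d0//.
  exact: integrableZl idist.
Qed.

(** Serves negative [rho], where [rho * W >= 0] requires [W <= 0]. The Dirac mass at the only pair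
    is a coupling of cost zero. *)
Lemma wasserstein_subsingleton P Q :
  (forall z z' : Z, z = z') -> wasserstein P Q <= 0.
Proof.
move=> Z1.
pose pt : Z * Z := (point, point).
pose pi : probability (borel (Z * Z)%type) R := \d_(pt : borel (Z * Z)%type).
apply: ereal_inf_lbound.
(* A subset of a one-point space is empty or everything, so all probabilities agree on it. *)
have piE (P' : probability (borel Z) R) (B : set (borel Z)) (g : Z * Z -> Z) :
    pi (g @^-1` B) = P' B.
  have [Bpt|Bpt] := pselect (B (point : Z)).
    have BT : B = [set: borel Z].
      by apply/seteqP; split => // z _; rewrite (Z1 z point).
    by rewrite BT preimage_setT !probability_setT.
  have B0 : B = set0.
    by apply/seteqP; split => // z Bz; apply: Bpt; rewrite (Z1 point z).
  by rewrite B0 preimage_set0 !measure0.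
exists pi; first by move=> B mB; split; exact: piE.
rewrite (_ : (fun _ => _) = cst 0%R) ?expectation_cst//.
by apply/funext => -[u v] /=; rewrite (Z1 u v) mdistxx.
Qed.

Lemma lipschitz_wasserstein P Q f rho :
  (forall z z', `|f z - f z'| <= rho * mdist z z')%R ->
  'E_P[f] - 'E_Q[f] <= rho%:E * wasserstein P Q /\
  'E_Q[f] - 'E_P[f] <= rho%:E * wasserstein P Q.
Proof.
move=> flip.
have [rho0|rho0] := ltP 0%R rho.
  rewrite /wasserstein -ereal_inf_pZl//.
  have m1 : measurable_fun [set: borel (Z * Z)%type]
      ((fun uv => uv.1) : borel (Z * Z)%type -> borel Z).
    by apply: (@borel_measurable_continuous (Z * Z)%type Z) => x;
      exact: cvg_fst.
  have m2 : measurable_fun [set: borel (Z * Z)%type]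
      ((fun uv => uv.2) : borel (Z * Z)%type -> borel Z).
    by apply: (@borel_measurable_continuous (Z * Z)%type Z) => x;
      exact: cvg_snd.
  have md : measurable_fun [set: borel (Z * Z)%type]
      ((fun uv => mdist (uv.1 : Z) uv.2) : borel (Z * Z)%type -> R).
    by apply: (@borel_measurable_continuous_real R (Z * Z)%type);
      exact: mdist_continuous.
  split; apply: le_ereal_inf_tmp => _ [_ [pi piPQ <-] <-].
    apply: (lipschitz_expectation_sub m1 m2) => // B mB.
    - by have [->] := piPQ B mB.
    - by have [_ ->] := piPQ B mB.
  (* The second inequality uses the same coupling with its projections exchanged. *)
  under eq_fun do rewrite metric_sym.
  apply: (lipschitz_expectation_sub m2 m1) => //.
  - by move=> B mB; have [_ ->] := piPQ B mB.
  - by move=> B mB; have [->] := piPQ B mB.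
  - by under eq_fun do rewrite metric_sym.
have fE : f = cst (f point).
  apply/funext => z; apply/eqP.
  rewrite -subr_eq0 -normr_le0 (le_trans (flip _ _))//.
  by rewrite mulr_le0_ge0 ?mdist_ge0.
suff rW : 0 <= rho%:E * wasserstein P Q by rewrite fE !expectation_cst subee.
(* For [rho = 0] the product is [0] even if the distance is infinite, by the convention
   [0 * +oo = 0]. *)
have [->|rhoN0] := eqVneq rho 0%R; first by rewrite mul0e.
rewrite mule_le0// ?lee_fin//; apply: wasserstein_subsingleton => z z'.
apply: (@mdist_positivity R Z); apply/eqP; rewrite eq_le mdist_ge0 andbT.
have rhoN : (rho < 0)%R by rewrite lt_neqAle rhoN0.
(* From [0 <= rho * mdist z z'] with [rho < 0] the distance is at most [0]. *)
by rewrite -(nmulr_rge0 _ rhoN) (le_trans _ (flip z z')).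
Qed.

End couplings.

Theorem theorem5 (R : realType) (Z : pmetricType R) (A : Type)
    (l : Z -> A -> R) (P Q : probability (borel Z) R) (aP aQ : A)
    (haP : gen_entropy l P = 'E_P[fun z => l z aP])
    (haQ : gen_entropy l Q = 'E_Q[fun z => l z aQ]) :
  (forall rhoQ : R,
     (forall z z' : Z, `|l z aQ - l z' aQ| <= rhoQ * mdist z z')%R ->
     gen_entropy l P - gen_entropy l Q <= rhoQ%:E * wasserstein P Q) /\
  (forall rhoP : R,
     (forall z z' : Z, `|l z aP - l z' aP| <= rhoP * mdist z z')%R ->
     gen_entropy l Q - gen_entropy l P <= rhoP%:E * wasserstein P Q).
Proof.
have le_entropy (S : probability (borel Z) R) (a : A) :
    gen_entropy l S <= 'E_S[fun z => l z a].
  by apply: ereal_inf_lbound; exists a.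
split=> rho /(lipschitz_wasserstein P Q) [PQ QP].
(* The action [aQ] is optimal for [Q] and merely a competitor for [P], so replacing
   [gen_entropy l P] by its expected loss under [P] only enlarges the difference. *)
- by rewrite haQ; apply: le_trans PQ; rewrite leeB.
- by rewrite haP; apply: le_trans QP; rewrite leeB.
Qed.
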